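(* For every integer $n\ge1$, $$\sum_{\substack{\mathbf w\in \mathrm{PF}_n\\ \mathrm{tie}(\mathbf w)=0}}t^{\mathrm{des}(\mathbf w)}=\frac1{n+1}\sum_{\mathbf w\in \mathrm{Smir}_{n,n+1}}t^{\mathrm{des}(\mathbf w)}.$$
   Context: A parking function of length $n$ is a word $\mathbf w=(w_1,\dots,w_n)\in[n]^n$, $[n]=\{1,\dots,n\}$, whose nondecreasing rearrangement $b_1\le\dots\le b_n$ satisfies $b_i\le i$ for all $i$; $\mathrm{PF}_n$ is the set of these. For a word $\mathbf w$ of length $n$, $\mathrm{des}(\mathbf w)$ is the number of $i\in[n-1]$ with $w_i>w_{i+1}$ and $\mathrm{tie}(\mathbf w)$ is the number of $i\in[n-1]$ with $w_i=w_{i+1}$. A Smirnov word is a word with no two equal adjacent letters; $\mathrm{Smir}_{r,m}$ is the set of Smirnov words of length $r$ on the alphabet $[m]$. *)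

(* Defs.v *)
From mathcomp Require Import all_boot all_order all_algebra.

Set Implicit Arguments.
Unset Strict Implicit.
Unset Printing Implicit Defensive.

(* The alphabet [m] = {1, ..., m} is represented by 'I_m, the ordinal i
   standing for the letter i + 1; [letters] recovers the word over {1, ..., m}. *)
Definition letters (m : nat) (w : seq 'I_m) : seq nat :=
  [seq (nat_of_ord i).+1 | i <- w].

Definition des (s : seq nat) : nat :=
  count (fun i => nth 0 s i.+1 < nth 0 s i) (iota 0 (size s).-1).

Definition tie (s : seq nat) : nat :=
  count (fun i => nth 0 s i == nth 0 s i.+1) (iota 0 (size s).-1).

(* Positions are 0-based, hence b_(i+1) <= i+1 below. *)
Definition PF (n : nat) : {set n.-tuple 'I_n} :=
  [set w : n.-tuple 'I_n |
    [forall i : 'I_n, nth 0 (sort leq (letters w)) i <= i.+1]].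

Definition Smir (r m : nat) : {set r.-tuple 'I_m} :=
  [set w : r.-tuple 'I_m | sorted (fun x y => x != y) (letters w)].

(* Main.v *)
(* Let N = n + 1. Adding 1 modulo N to every letter of a Smirnov word changes the
   number of descents only when exactly one end of the word is the letter N; in
   that case first move that N to the other end. The result is a
   descent-preserving bijection of Smir_{n,N} whose effect on the multiset of
   letters is the cyclic shift. By Pollak's argument exactly one of the N cyclic
   shifts of a multiset of n letters of [N] is that of a parking function, so
   summing over the N iterates counts every tie-free parking function N times. *)

Require Import Defs.
From mathcomp Require Import all_boot all_order all_algebra.
From mathcomp Require Import zify.

Set Implicit Arguments.
Unset Strict Implicit.
Unset Printing Implicit Defensive.

(** * Descents, ties and Smirnov words *)

Definition smirnov (T : eqType) (s : seq T) : bool :=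
  sorted (fun x y => x != y) s.

Lemma smirnov_letters (m : nat) (s : seq 'I_m) :
  sorted (fun x y => x != y) (letters s) = smirnov s.
Proof. by rewrite /letters sorted_map. Qed.

Lemma des_cons2 (x y : nat) (s : seq nat) :
  des [:: x, y & s] = (y < x) + des (y :: s).
Proof. by rewrite /des /= -(addn0 1) iotaDl count_map. Qed.

Lemma des_rcons (x y : nat) (s : seq nat) :
  des (rcons (x :: s) y) = des (x :: s) + (y < last x s).
Proof.
elim: s x => [|z s IHs] x; first by rewrite /= des_cons2 /des /= addnC.
by rewrite !rcons_cons !des_cons2 -rcons_cons IHs addnA.
Qed.

Lemma tie_eq0 (s : seq nat) : (tie s == 0) = smirnov s.
Proof.
case: s => // x s; elim: s x => // y s IHs x.
rewrite [RHS]/smirnov /= -[path _ y s]/(smirnov (y :: s)) -IHs /tie /= -(addn0 1) iotaDl count_map.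
by case: (x =P y).
Qed.

(** * The descent-preserving cyclic shift *)

Section CyclicShift.

Variable n : nat.
Implicit Type s : seq 'I_n.+1.

Let peak (x : 'I_n.+1) := x == ord_max.

(** Only pairs containing the letter N change their order under the shift. For adjacent [x], [y] the
    change is [peak y - peak x], which telescopes along the word. *)
Lemma des_letters_map_ordS (x : 'I_n.+1) s : smirnov (x :: s) ->
  des (letters (map (@ordS _) (x :: s))) + peak x
  = des (letters (x :: s)) + peak (last x s).
Proof.
elim: s x => //= y s IHs x /andP[neq_xy smir_s].
rewrite !des_cons2 /=.
have {}IHs := IHs y smir_s; rewrite /= in IHs.
suff : (((y.+1 %% n.+1).+1 < (x.+1 %% n.+1).+1) + peak x
         = (y.+1 < x.+1) + peak y) by lia.
have modS (z : 'I_n.+1) : z.+1 %% n.+1 = if peak z then 0 else z.+1.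
  rewrite /peak -val_eqE /=; case: eqP => [->|nz]; first by rewrite modnn.
  by rewrite modn_small //; have := ltn_ord z; lia.
rewrite !modS /peak -!val_eqE /= in neq_xy *.
have := ltn_ord x; have := ltn_ord y.
by case: (nat_of_ord x =P n) neq_xy; case: (nat_of_ord y =P n) => /=; lia.
Qed.

Definition twist s : seq 'I_n.+1 :=
  if peak (head ord0 s) == peak (last ord0 s) then s
  else if peak (head ord0 s) then rot 1 s else rotr 1 s.

Lemma perm_twist s : perm_eq (twist s) s.
Proof.
by rewrite /twist; do 2!case: ifP => // _; rewrite ?perm_rot ?perm_rotr.
Qed.

(** In the moving cases [x :: u] is the word without its end letter N. One of its ends differs from
    N by the Smirnov condition, the other because only one end of [s] is N; hence N can be attached
    on either side. *)
Variant twist_spec s : seq 'I_n.+1 -> Prop :=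
  | TwistId of peak (head ord0 s) = peak (last ord0 s) : twist_spec s s
  | TwistRot x u of s = ord_max :: x :: u & ~~ peak x & ~~ peak (last x u) :
      twist_spec s (rcons (x :: u) ord_max)
  | TwistRotr x u of s = rcons (x :: u) ord_max & ~~ peak x & ~~ peak (last x u) :
      twist_spec s (ord_max :: x :: u).

Lemma twistP s : smirnov s -> twist_spec s (twist s).
Proof.
rewrite /twist; case: eqP => [e _|]; first exact: TwistId.
case: s => [|x [|y u]] //=.
have [/eqP-> | px] := boolP (peak x) => /= ne /andP[neq_xy smir_u].
  rewrite rot1_cons; apply: TwistRot => //; first by rewrite /peak eq_sym.
  by case: (peak _) ne.
case/lastP: u ne smir_u => [|u z] /=.
  case: (boolP (peak y)) => // /eqP-> _ _.
  exact: (@TwistRotr _ x [::]).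
rewrite last_rcons => pz; rewrite rcons_path => /andP[_ neq_z].
have /eqP{}pz : peak z by case: (peak z) pz.
rewrite pz -!rcons_cons rotr1_rcons; apply: TwistRotr => //.
by rewrite /peak -pz.
Qed.

Lemma smirnov_twist s : smirnov s -> smirnov (twist s).
Proof.
move=> smir_s; case: (twistP smir_s) (smir_s) => // x u -> px pl.
  by rewrite /smirnov /= rcons_path => /andP[_ ->].
by rewrite /smirnov /= rcons_path => /andP[-> _]; rewrite andbT eq_sym.
Qed.

Lemma twistK s : smirnov s -> twist (twist s) = s.
Proof.
move=> smir_s; case: (twistP smir_s) => [|x u -> px pl|x u -> px pl].
- by rewrite /twist => ->; rewrite eqxx.
- rewrite /twist /= last_rcons (negPf px) /peak eqxx /=.
  by rewrite -rcons_cons rotr1_rcons.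
by rewrite /twist /= (negPf pl) /peak eqxx rot1_cons.
Qed.

Definition cyclic_shift s : seq 'I_n.+1 := map (@ordS _) (twist s).

Lemma perm_cyclic_shift s : perm_eq (cyclic_shift s) (map (@ordS _) s).
Proof. exact/perm_map/perm_twist. Qed.

Lemma smirnov_cyclic_shift s : smirnov s -> smirnov (cyclic_shift s).
Proof.
move=> /smirnov_twist; rewrite /smirnov /cyclic_shift sorted_map.
by apply: sub_sorted => x y; rewrite /= (inj_eq (@ordS_inj _)).
Qed.

Lemma cyclic_shift_inj s1 s2 : smirnov s1 -> smirnov s2 ->
  cyclic_shift s1 = cyclic_shift s2 -> s1 = s2.
Proof.
move=> smir1 smir2 /(inj_map (@ordS_inj _)) eq12.
by rewrite -(twistK smir1) eq12 twistK.
Qed.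

(* Shifting the letters alone creates a descent when the word ends with the
   largest letter and destroys one when it begins with it; moving that letter
   to the other end compensates exactly. *)
Lemma des_cyclic_shift s : smirnov s ->
  des (letters (cyclic_shift s)) = des (letters s).
Proof.
move=> smir_s; have := smirnov_twist smir_s.
have des_ends (x : 'I_n.+1) u : ~~ peak x ->
  des (letters (ord_max :: x :: u))
    = (des (letters (rcons (x :: u) ord_max))).+1.
  move=> px; rewrite /letters map_rcons /= des_cons2 -rcons_cons des_rcons.
  rewrite last_map; rewrite /peak -val_eqE /= in px.
  by have := ltn_ord x; have := ltn_ord (last x u); lia.
rewrite /cyclic_shift; case: (twistP smir_s) => [|x u -> px pl|x u -> px pl].
- case: s smir_s => // x s _ /= eq_peak /des_letters_map_ordS.
  by rewrite eq_peak => /addIn.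
- rewrite rcons_cons => /des_letters_map_ordS.
  by rewrite last_rcons (negPf px) des_ends // /peak eqxx addn0 addn1.
move=> /des_letters_map_ordS.
by rewrite /= (negPf pl) /peak eqxx addn0 addn1 des_ends // => -[].
Qed.

End CyclicShift.

(** * Pollak's argument *)

Definition parking (n : nat) (s : seq 'I_n.+1) : bool :=
  [forall i : 'I_n.+1, i <= count (fun x : 'I_n.+1 => x < i) s].

Lemma perm_parking (n : nat) (s t : seq 'I_n.+1) :
  perm_eq s t -> parking s = parking t.
Proof. by move=> /permP eq_st; apply: eq_forallb => i; rewrite eq_st. Qed.

Lemma iter_ordSE (n k : nat) (x : 'I_n.+1) :
  iter k (@ordS _) x = (x + k) %% n.+1 :> nat.
Proof.
elim: k => [|k IHk]; first by rewrite addn0 modn_small.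
by rewrite iterS /= IHk -[(_ %% _).+1]addn1 modnDml addn1 addnS.
Qed.

(** Shifting by N - j subtracts [j] modulo N, so the letters that land below [i] come from the
    cyclic interval of [i] letters starting at [j]; the second case is the one where it wraps
    around. *)
Lemma count_iter_ordS (n : nat) (s : seq 'I_n.+1) (i j : 'I_n.+1) :
  count (fun x : 'I_n.+1 => x < i) (map (iter (n.+1 - j) (@ordS _)) s)
    + count (fun x : 'I_n.+1 => x < j) s
  = if i + j < n.+1 then count (fun x : 'I_n.+1 => x < i + j) s
    else size s + count (fun x : 'I_n.+1 => x < i + j - n.+1) s.
Proof.
elim: s => [|x s IHs] /=; first by case: ifP.
have xE : iter (n.+1 - j) (@ordS _) x
    = (if j <= x then x - j else x + n.+1 - j) :> nat.
  rewrite iter_ordSE; have := ltn_ord x; have := ltn_ord j.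
  case: (leqP j x) => le_jx lt_j lt_x.
    by rewrite (_ : x + _ = x - j + n.+1) ?modnDr ?modn_small; lia.
  by rewrite modn_small; lia.
rewrite xE; have := ltn_ord x; have := ltn_ord j; have := ltn_ord i.
by move: IHs; case: ifP; case: ifP; lia.
Qed.

(* Minimizing this key selects the leftmost minimum of the walk
   [count (< j) s - j]. *)
Lemma parking_iter_ordS (n : nat) (s : seq 'I_n.+1) (j : 'I_n.+1) :
  size s = n ->
  let key (i : 'I_n.+1) :=
    (count (fun x : 'I_n.+1 => x < i) s + (n - i)) * n.+1 + i in
  parking (map (iter (n.+1 - j) (@ordS _)) s) = [forall i, key j <= key i].
Proof.
(* The walk at positions after [j] must be at least its value at [j]. Positions before [j] are
   reached by wrapping and, since [size s] is N - 1, must be strictly higher. The final [+ i] in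
   [key] encodes this tie-break. *)
move=> size_s key; apply/forallP/forallP => H i;
  have lt_i := ltn_ord i; have lt_j := ltn_ord j.
  case: (leqP j i) => le_ji.
    have lt_k : i - j < n.+1 by lia.
    move: (H (Ordinal lt_k)) (count_iter_ordS s (Ordinal lt_k) j) => /=.
    by rewrite subnK // lt_i /key; nia.
  have lt_k : i + n.+1 - j < n.+1 by lia.
  move: (H (Ordinal lt_k)) (count_iter_ordS s (Ordinal lt_k) j) => /=.
  rewrite subnK; last by lia.
  by rewrite addnK ltnNge leq_addl size_s /key /=; nia.
have := count_iter_ordS s i j; case: ltnP => le_ij.
  by have := H (Ordinal le_ij); rewrite /key /=; nia.
have lt_k : i + j - n.+1 < n.+1 by lia.
by have := H (Ordinal lt_k); rewrite /key /= size_s; nia.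
Qed.

(** The remainder of [key i] modulo N is [i], so [key] is injective and has a single minimizer. *)
Lemma ex_unique_parking_shift (n : nat) (s : seq 'I_n.+1) : size s = n ->
  exists j0 : 'I_n.+1, forall j : 'I_n.+1,
    parking (map (iter (n.+1 - j) (@ordS _)) s) = (j == j0).
Proof.
move=> size_s.
pose key (i : 'I_n.+1) :=
  (count (fun x : 'I_n.+1 => x < i) s + (n - i)) * n.+1 + i.
have key_inj : injective key.
  move=> i j /(congr1 (modn^~ n.+1)).
  by rewrite /key !modnMDl !modn_small //; apply: val_inj.
have [j0 _ j0_min] := @arg_minnP _ (ord0 : 'I_n.+1) xpredT key isT.
exists j0 => j; rewrite parking_iter_ordS // -/key; apply/forallP/eqP => [H | -> i].
  by apply: key_inj; apply/eqP; rewrite eqn_leq H j0_min.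
exact: j0_min.
Qed.

(** * Averaging over the shifts *)

Definition shift_word (n r : nat) (w : r.-tuple 'I_n.+1) : r.-tuple 'I_n.+1 :=
  insubd w (cyclic_shift w).

(** The shift preserves length, so the default value of [insubd] is never taken. *)
Lemma val_shift_word (n r : nat) (w : r.-tuple 'I_n.+1) :
  shift_word w = cyclic_shift w :> seq _.
Proof.
by rewrite val_insubd (perm_size (perm_cyclic_shift w)) size_map size_tuple eqxx.
Qed.

Lemma in_Smir (r m : nat) (w : r.-tuple 'I_m) : (w \in Smir r m) = smirnov w.
Proof. by rewrite inE smirnov_letters. Qed.

Lemma shift_word_Smir (n r : nat) : @shift_word n r @: Smir r n.+1 = Smir r n.+1.
Proof.
apply/eqP; rewrite eqEcard; apply/andP; split.
  apply/subsetP => _ /imsetP[w smir_w ->].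
  by rewrite in_Smir val_shift_word smirnov_cyclic_shift -?in_Smir.
rewrite card_in_imset // => v w smir_v smir_w /(congr1 val) /=.
rewrite !val_shift_word => /cyclic_shift_inj eq_vw.
by apply/val_inj/eq_vw; rewrite -in_Smir.
Qed.

(** Being parking depends only on the multiset of letters, so this carries Pollak's argument over
    from plain shifts to the iterates of [shift_word]. *)
Lemma perm_iter_shift_word (n r k : nat) (w : r.-tuple 'I_n.+1) :
  perm_eq (iter k (@shift_word n r) w) (map (iter k (@ordS _)) w).
Proof.
elim: k => [|k IHk] /=; first by rewrite map_id.
rewrite val_shift_word (perm_trans (perm_cyclic_shift _)) //.
by rewrite (map_comp (@ordS _) (iter k (@ordS _))) perm_map.
Qed.

Import GRing.Theory.
Local Open Scope ring_scope.

Lemma sum_iter_shift_word (V : nmodType) (n r k : nat) (F : pred (seq 'I_n.+1))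
    (G : nat -> V) :
  \sum_(w in Smir r n.+1 | F (iter k (@shift_word n r) w)) G (des (letters w))
  = \sum_(w in Smir r n.+1 | F w) G (des (letters w)).
Proof.
elim: k F => [//|k IHk] F.
rewrite -(IHk F) [RHS]big_mkcondr -[in RHS]shift_word_Smir.
rewrite big_imset => [|v w smir_v smir_w /(congr1 val) /=]; last first.
  rewrite !val_shift_word => /cyclic_shift_inj eq_vw.
  by apply/val_inj/eq_vw; rewrite -in_Smir.
rewrite big_mkcondr; apply: eq_bigr => w smir_w.
by rewrite -(des_cyclic_shift (s := w)) -?in_Smir // -val_shift_word -iterSr.
Qed.

(** Double counting: the [j]-th of N copies of the right-hand sum is filtered by the iterate of
    order N - j. After exchanging the sums, each Smirnov word survives for exactly one [j]. *)
Lemma sum_Smir_parking (n : nat) (V : nmodType) (G : nat -> V) :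
  \sum_(w in Smir n n.+1) G (des (letters w))
  = (\sum_(w in Smir n n.+1 | parking w) G (des (letters w))) *+ n.+1.
Proof.
rewrite -[X in _ *+ X](card_ord n.+1) -sumr_const.
under [RHS]eq_bigr => j _ do
  rewrite -(@sum_iter_shift_word V n n (n.+1 - j) (@parking n) G) big_mkcondr.
rewrite exchange_big; apply: eq_bigr => w _ /=.
have [j0 j0P] := @ex_unique_parking_shift n w (size_tuple w).
under eq_bigr => j _ do rewrite (perm_parking (perm_iter_shift_word _ _)) j0P.
by rewrite -big_mkcond big_pred1_eq.
Qed.

(** The bound on the i-th smallest letter says that at least i letters are at most i. *)
Lemma parking_PF (n : nat) (w : n.-tuple 'I_n) :
  (w \in PF n) = parking (map (widen_ord (leqnSn n)) w).
Proof.
rewrite inE; set b := sort leq _.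
have sorted_b : sorted leq b by apply: sort_sorted; exact: leq_total.
have count_b i :
    count (fun x : 'I_n.+1 => x < i)%N (map (widen_ord (leqnSn n)) w)
    = count (leq^~ i) b.
  by rewrite /b count_sort /letters !count_map; apply: eq_count.
have size_b : size b = n by rewrite size_sort size_map size_tuple.
apply/forallP/forallP => /= H i.
  rewrite count_b; case: i => -[|k] //= lt_k.
  suff take_b : count (leq^~ k.+1) (take k.+1 b) = k.+1.
    by rewrite -[X in count _ X](cat_take_drop k.+1 b) count_cat take_b leq_addr.
  have size_take_b : size (take k.+1 b) = k.+1 by rewrite size_takel ?size_b.
  apply/eqP; rewrite -[X in _ == X]size_take_b -all_count.
  apply/(all_nthP 0%N) => l; rewrite size_take_b => lt_l.
  (* Entries up to the 0-based index [k] are at most the entry at [k], which is at most [k.+1]. *)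
  rewrite nth_take //=; apply: leq_trans (H (Ordinal (lt_k : (k < n)%N))) => /=.
  apply: sorted_leq_nth => //; [exact: leq_trans|rewrite inE size_b; lia..].
have lt_i : (i.+1 < n.+1)%N by have := ltn_ord i.
have := H (Ordinal lt_i); rewrite count_b /= => le_i.
exact: (@Order.PreorderTheory.nth_count_le _ nat).
Qed.

Lemma sum_PF_widen (n : nat) (V : nmodType) (G : nat -> V) : (0 < n)%N ->
  \sum_(w in PF n | tie (letters w) == 0%N) G (des (letters w))
  = \sum_(w in Smir n n.+1 | parking w) G (des (letters w)).
Proof.
(* A successor length makes ['I_n.+1] inhabited, as [inord] requires. *)
case: n => // n _.
pose up (w : n.+1.-tuple 'I_n.+1) := map_tuple (widen_ord (leqnSn n.+1)) w.
pose down (w : n.+1.-tuple 'I_n.+2) := map_tuple (fun x : 'I_n.+2 => inord x : 'I_n.+1) w.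
have letters_up w : letters (up w) = letters w.
  by rewrite /letters /= -map_comp; apply: eq_map.
have upK w : down (up w) = w.
  apply: val_inj; rewrite /= -map_comp map_id_in // => x _ /=.
  exact: inord_val.
rewrite [RHS](reindex_onto up down) => [|w /andP[_ park_w]].
  apply: eq_big => [w | w _]; last by rewrite letters_up.
  by rewrite upK eqxx andbT !inE letters_up -parking_PF inE tie_eq0 andbC.
apply: val_inj; rewrite /= -map_comp map_id_in // => x w_x; apply: val_inj => /=.
(* The parking condition at [ord_max] forces all letters below the top one, so [down] loses
   nothing. *)
rewrite inordK //; move/forallP/(_ ord_max): park_w => /=.
rewrite -[X in (X <= _)%N](size_tuple w) => le_w.
have : all (fun x : 'I_n.+2 => x < n.+1)%N w by rewrite all_count eqn_leq count_size.
by move/allP; apply.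
Qed.

Theorem theorem3p4 (n : nat) (hn : (1 <= n)%N) :
  \sum_(w in PF n | tie (letters w) == 0%N) 'X^(des (letters w))
  = (n.+1%:R)^-1 *: \sum_(w in Smir n n.+1) 'X^(des (letters w)) :> {poly rat}.
Proof.
rewrite (sum_PF_widen (fun k => 'X^k)) // (sum_Smir_parking n (fun k => 'X^k)).
by rewrite -scaler_nat scalerA mulVf ?scale1r // Num.Theory.pnatr_eq0.
Qed.
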